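(* Suppose $n\neq2$. Then $V^+$ is a representation of $Z_n\otimes\mathrm{Cl}(\eta)^{\mathrm{op}}$ (with $Z_n$ acting on the left and $\mathrm{Cl}(\eta)^{\mathrm{op}}$ acting by right multiplication), whose irreducible subrepresentations correspond to those of the regular representation of the Clifford algebra $\mathrm{Cl}(\eta)$. In particular, when $n$ is even, $V^+$ is an irreducible representation of $Z_n\otimes\mathrm{Cl}(\eta)^{\mathrm{op}}$.
   Context: Fix $n\ge1$ and an invertible complex matrix $\eta=(\eta^{ij})$ with $\eta^{ij}=\eta^{ji}$ and inverse $(\eta_{ij})$. $\mathrm{Cl}(\eta)$ is the Clifford algebra generated by $\gamma^1,\dots,\gamma^n$ with $\gamma^i\gamma^j+\gamma^j\gamma^i=2\eta^{ij}$. $\mathcal{A}=W(2n|n)$ is the associative superalgebra generated by even $x^1,\dots,x^n,\partial_1,\dots,\partial_n$ and odd $\gamma^1,\dots,\gamma^n$ with relations $x^ix^j=x^jx^i$, $\partial_i\partial_j=\partial_j\partial_i$, $\partial_ix^j-x^j\partial_i=\delta_i^j$, $\gamma^i$ commuting with $x^j,\partial_j$, and the Clifford relations. Repeated indices are summed; $\partial^i=\eta^{ij}\partial_j$. $\mathcal{A}$ acts on $V=\mathrm{Cl}(\eta)\otimes\mathbb{C}[x^1,\dots,x^n]$ ($x^i,\gamma^i$ by left multiplication, $\partial_i$ by $\partial/\partial x^i$). $X=\frac{\sqrt{-1}}{\sqrt2}\gamma^i\partial_i$, $E=-\frac12\partial^i\partial_i$, and $V^+=\{v\in V:Xv=0\}$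 is the space of Clifford-valued polynomial solutions of the massless Dirac equation. $I=\mathcal{A}X+\mathcal{A}E$, and the reduction algebra is $Z_n=N_{\mathcal{A}}(I)/I$ with $N_{\mathcal{A}}(I)=\{a\in\mathcal{A}:Ia\subset I\}$; it acts on $V^+$ by left action of representatives. *)

(* Defs.v *)
From HB Require Import structures.
From mathcomp Require Import all_boot all_order all_algebra.
From mathcomp Require Import reals.
From mathcomp Require Import complex.
From mathcomp Require Import mpoly.
Set Implicit Arguments. Unset Strict Implicit. Unset Printing Implicit Defensive.
Import GRing.Theory Num.Theory.
Local Open Scope ring_scope.

Section WeylCliffordDefs.
Variable R : realType.
Local Notation C := (R[i]).
Variable n : nat.
Variable eta : 'M[C]_n.

Definition is_alg_morph (A B : algType C) (f : A -> B) : Prop :=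
  (forall a b, f (a + b) = f a + f b) /\ (forall a b, f (a * b) = f a * f b) /\
  f 1 = 1 /\ (forall (c : C) a, f (c *: a) = c *: f a).

Definition clifford_rel (B : algType C) (g : 'I_n -> B) : Prop :=
  forall i j, g i * g j + g j * g i = (2 * eta i j)%:A.

Definition is_clifford_algebra (Cl : algType C) (gam : 'I_n -> Cl) : Prop :=
  clifford_rel gam /\
  forall (B : algType C) (b : 'I_n -> B), clifford_rel b ->
    (exists f : Cl -> B, is_alg_morph f /\ forall i, f (gam i) = b i) /\
    (forall f1 f2 : Cl -> B, is_alg_morph f1 -> is_alg_morph f2 ->
       (forall i, f1 (gam i) = f2 (gam i)) -> forall a, f1 a = f2 a).

Definition weyl_clifford_rel (B : algType C) (x d g : 'I_n -> B) : Prop :=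
  (forall i j, x i * x j = x j * x i) /\
  (forall i j, d i * d j = d j * d i) /\
  (forall i j, d i * x j - x j * d i = (i == j)%:R) /\
  (forall i j, g i * x j = x j * g i) /\
  (forall i j, g i * d j = d j * g i) /\
  clifford_rel g.

Definition is_weyl_clifford (A : algType C) (x d g : 'I_n -> A) : Prop :=
  weyl_clifford_rel x d g /\
  forall (B : algType C) (bx bd bg : 'I_n -> B), weyl_clifford_rel bx bd bg ->
    (exists f : A -> B, is_alg_morph f /\
       forall i, ((f (x i) = bx i) /\ (f (d i) = bd i) /\ (f (g i) = bg i))) /\
    (forall f1 f2 : A -> B, is_alg_morph f1 -> is_alg_morph f2 ->
       (forall i, ((f1 (x i) = f2 (x i)) /\ (f1 (d i) = f2 (d i)) /\ (f1 (g i) = f2 (g i)))) -> forall a, f1 a = f2 a).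

Section InA.
Variables (A : algType C) (x d g : 'I_n -> A).

Definition Xel : A := ('i / sqrtC 2) *: \sum_(i < n) g i * d i.
Definition Eel : A := - (1 / 2 : C) *: \sum_(i < n) \sum_(j < n) eta i j *: (d j * d i).

Definition Iideal (a : A) : Prop := exists b c : A, a = b * Xel + c * Eel.
Definition NormI (a : A) : Prop := forall b, Iideal b -> Iideal (b * a).
End InA.

Section Rep.
Variables (Cl : algType C) (gam : 'I_n -> Cl).
(* V = Cl(eta) (x) C[x^1..x^n] *)
Local Notation V := {mpoly Cl[n]}.
Variables (A : algType C) (x d g : 'I_n -> A) (rho : A -> V -> V).

Definition is_WCl_action : Prop :=
  (((forall a b v, rho (a + b) v = rho a v + rho b v)) /\
  ((forall a b v, rho (a * b) v = rho a (rho b v))) /\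
  ((forall v, rho 1 v = v)) /\
  ((forall (c : C) a v, rho (c *: a) v = (c%:A : Cl)%:MP * rho a v)) /\
  ((forall a v w, rho a (v + w) = rho a v + rho a w)) /\
  ((forall i v, rho (x i) v = 'X_i * v)) /\
  ((forall i v, rho (g i) v = (gam i)%:MP * v)) /\
  ((forall i v, rho (d i) v = v^`M(i)))).

Definition Vplus (v : V) : Prop := rho (Xel d g) v = 0.

(* subrepresentations of V^+ for Z_n (x) Cl(eta)^op: Z_n = N(I)/I acts through
   representatives, Cl(eta)^op by right multiplication *)
Definition subrep (W : V -> Prop) : Prop :=
  (forall v, W v -> Vplus v) /\ W 0 /\
  (forall v w, W v -> W w -> W (v + w)) /\
  (forall a v, NormI d g a -> W v -> W (rho a v)) /\
  (forall (c : Cl) v, W v -> W (v * c%:MP)).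

Definition irred_subrep (W : V -> Prop) : Prop :=
  subrep W /\ (exists v, W v /\ v <> 0) /\
  (forall W', subrep W' -> (forall v, W' v -> W v) ->
        (forall v, W' v -> v = 0) \/ (forall v, W v -> W' v)).

Definition deg0 (W : V -> Prop) : Cl -> Prop := fun c => W c%:MP.
End Rep.

Section Regular.
Variable Cl : algType C.
(* subrepresentations of the regular representation of Cl(eta)
   (Cl acting on itself by left and right multiplication) = two-sided ideals *)
Definition reg_subrep (J : Cl -> Prop) : Prop :=
  J 0 /\ (forall a b, J a -> J b -> J (a + b)) /\
  (forall a c, J c -> J (a * c)) /\ (forall a c, J c -> J (c * a)).

Definition reg_irred (J : Cl -> Prop) : Prop :=
  reg_subrep J /\ (exists c, J c /\ c <> 0) /\
  (forall J', reg_subrep J' -> (forall c, J' c -> J c) ->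
        (forall c, J' c -> c = 0) \/ (forall c, J c -> J' c)).
End Regular.

End WeylCliffordDefs.

(* Main.v *)
Require Import Defs.
From HB Require Import structures.
From mathcomp Require Import all_boot all_order all_algebra.
From mathcomp Require Import reals boolp.
From mathcomp Require Import complex.
From mathcomp Require Import mpoly ring.
From Stdlib Require Ncring Ncring_tac.
Import GRing.Theory Num.Theory.
Set Implicit Arguments. Unset Strict Implicit. Unset Printing Implicit Defensive.
Local Open Scope ring_scope.

(** Write [D] for the Dirac operator [\sum_i g i * d i], so that [X] is a nonzero
    multiple of [D], [E = X^2] and [I = A D].  With [M = \sum x_i g^i] one has
    [D M + M D = H := n + 2 euler], and from this [N(I)] is seen to contain, besides
    [d i] and [euler], the elements [g i (H - 2) - 2 M d^i] and
    [x i H - M g i - M^2 d^i].  On constants the former is [(n - 2) g i], so for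
    [n <> 2] the constants of a subrepresentation [W] form a two-sided ideal [J].
    Differentiating shows that all coefficients of elements of [W] lie in [J];
    conversely, on [V^+] the sum [\sum_i (x i H - M g i - M^2 d^i) d i] equals
    [euler (H - 2)], which is a positive integer in every positive degree, so by
    induction on the degree [W] contains every solution with coefficients in [J].
    Thus [W |-> J] is an inclusion-preserving bijection onto the two-sided ideals.

    For [n] even these are trivial: [a |-> \sum_i g i a g_i] preserves ideals and acts on
    the degree-[m] part of the filtered algebra [Cl] by [(-1)^m (n - 2 m)], which are
    pairwise distinct numbers; hence a nonzero element of minimal degree in an ideal is
    an eigenvector, its supercommutators with the generators vanish, and it is a
    scalar. *)

(** * Generation by the defining generators *)

Definition alg_closed {K : nzRingType} {B : algType K} (P : B -> Prop) : Prop :=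
  [/\ P 1, (forall a b, P a -> P b -> P (a + b)),
      (forall a b, P a -> P b -> P (a * b)) &
      (forall (c : K) a, P a -> P (c *: a))].

Section Subalgebra.
Variables (K : nzRingType) (B : algType K) (P : B -> Prop).
Hypothesis P_closed : alg_closed P.

(** The closure proof is an argument so that the term itself carries it, and the subalgebra
    structure can be inferred from the predicate. *)
Definition subalg_pred of alg_closed P : {pred B} := fun a => `[< P a >].

Lemma subalg_pred_closed : GRing.subalg_closed (subalg_pred P_closed).
Proof.
case: (P_closed) => P1 PD PM PZ; split; first exact/asboolP.
- by move=> c a b /asboolP ha /asboolP hb; apply/asboolP/PD => //; apply: PZ.
- by move=> a b /asboolP ha /asboolP hb; apply/asboolP/PM.
Qed.

HB.instance Definition _ :=
  GRing.isSubalgClosed.Build K B (subalg_pred P_closed) subalg_pred_closed.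

Definition subalg : Type := {a | a \in subalg_pred P_closed}.
HB.instance Definition _ := SubType.on subalg.
HB.instance Definition _ := Choice.on subalg.
HB.instance Definition _ := [SubChoice_isSubAlgebra of subalg by <:].
End Subalgebra.

Section Generation.
Variables (R : realType).
Local Notation C := (R[i]).

Lemma subalg_morph (B : algType C) (P : B -> Prop) : alg_closed P ->
  exists (S : algType C) (io : S -> B), [/\ is_alg_morph io, injective io,
    (forall s, P (io s)) & forall b, P b -> exists s, io s = b].
Proof.
move=> Pc; exists (subalg Pc), val; split; last 1 first.
- by move=> b /asboolP Pb; exists (Sub b Pb); rewrite SubK.
- by do !split.
- exact: val_inj.
- by move=> s; apply/asboolP; apply: (valP s).
Qed.

Lemma is_alg_morph_comp (B1 B2 B3 : algType C) (f : B2 -> B3) (h : B1 -> B2) :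
  is_alg_morph f -> is_alg_morph h -> is_alg_morph (f \o h).
Proof.
move=> [fD [fM [f1 fZ]]] [hD [hM [h1 hZ]]]; do !split=> *.
- by rewrite /= hD fD.
- by rewrite /= hM fM.
- by rewrite /= h1 f1.
- by rewrite /= hZ fZ.
Qed.

Variables (n : nat) (eta : 'M[C]_n).

(** By the universal property [Cl] maps to the subalgebra cut out by [P]. Followed by the inclusion,
    this map fixes the generators, so by uniqueness it is the identity. *)
Lemma clifford_ind (Cl : algType C) (gam : 'I_n -> Cl) (P : Cl -> Prop) :
  is_clifford_algebra eta gam -> alg_closed P -> (forall i, P (gam i)) ->
  forall a, P a.
Proof.
move=> [grel guniv] /subalg_morph [S [io [ioM ioI ioP ioS]]] Pg.
have [s sE] := choice (fun i => ioS _ (Pg i)).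
have [ioD [ioMu [io1 ioZ]]] := ioM.
have srel : clifford_rel eta s.
  by move=> i j; apply: ioI; rewrite ioD !ioMu !sE grel ioZ io1.
have [[f [fM fE]] _] := guniv _ _ srel => a.
suff fK : io (f a) = a by rewrite -fK; apply: ioP.
have [_ uniq] := guniv _ _ grel.
apply: (uniq (io \o f) id _ _ _ a); first exact: is_alg_morph_comp.
- by do !split.
- by move=> i /=; rewrite fE sE.
Qed.

Lemma weyl_clifford_ind (A : algType C) (x d g : 'I_n -> A) (P : A -> Prop) :
  is_weyl_clifford eta x d g -> alg_closed P ->
  (forall i, P (x i)) -> (forall i, P (d i)) -> (forall i, P (g i)) ->
  forall a, P a.
Proof.
move=> [rel univ] /subalg_morph [S [io [ioM ioI ioP ioS]]] Px Pd Pg.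
have [sx sxE] := choice (fun i => ioS _ (Px i)).
have [sd sdE] := choice (fun i => ioS _ (Pd i)).
have [sg sgE] := choice (fun i => ioS _ (Pg i)).
have [ioD [ioMu [io1 ioZ]]] := ioM.
have io0 : io 0 = 0 by apply: (addrI (io 0)); rewrite -ioD !addr0.
have srel : weyl_clifford_rel eta sx sd sg.
  have ioB a b : io (a - b) = io a - io b by rewrite ioD -scaleN1r ioZ scaleN1r.
  case: rel => [r1 [r2 [r3 [r4 [r5 r6]]]]].
  split; [|split; [|split; [|split; [|split]]]]; move=> i j; apply: ioI.
  - by rewrite !ioMu !sxE r1.
  - by rewrite !ioMu !sdE r2.
  - by rewrite ioB !ioMu sdE sxE r3; case: eqP; rewrite ?io1 ?io0.
  - by rewrite !ioMu sxE sgE r4.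
  - by rewrite !ioMu sdE sgE r5.
  - by rewrite ioD !ioMu !sgE r6 ioZ io1.
have [[f [fM fE]] _] := univ _ _ _ _ srel => a.
suff fK : io (f a) = a by rewrite -fK; apply: ioP.
have [_ uniq] := univ _ _ _ _ rel.
apply: (uniq (io \o f) id _ _ _ a); first exact: is_alg_morph_comp.
- by do !split.
- by move=> i /=; have [-> [-> ->]] := fE i; rewrite sxE sdE sgE.
Qed.

End Generation.

(** * Simplicity of the Clifford algebra in even dimension *)

Section CliffordSums.
Variables (R : realType) (n : nat).
Local Notation C := (R[i]).
Variable eta : 'M[C]_n.
Hypotheses (eta_sym : eta^T = eta) (eta_inv : eta \in unitmx).

Lemma eta_symE i j : eta i j = eta j i.
Proof. by rewrite -[in LHS]eta_sym mxE. Qed.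

Lemma inv_eta_symE i j : invmx eta i j = invmx eta j i.
Proof.
have eT : (invmx eta)^T = invmx eta by rewrite trmx_inv eta_sym.
by rewrite -[in LHS]eT mxE.
Qed.

Lemma sum_mulmx1 (P Q : 'M[C]_n) (V : lmodType C) (f : 'I_n -> V) (k : 'I_n) :
  P *m Q = 1%:M -> \sum_i \sum_j P k i *: (Q i j *: f j) = f k.
Proof.
move=> PQ; rewrite exchange_big /=.
transitivity (\sum_j (k == j)%:R *: f j).
  apply: eq_bigr => j _; under eq_bigr do rewrite scalerA.
  rewrite -scaler_suml; congr (_ *: _).
  by move/matrixP: PQ => /(_ k j); rewrite !mxE.
rewrite (bigD1 k) //= eqxx scale1r big1 ?addr0 // => j.
by rewrite eq_sym => /negbTE ->; rewrite scale0r.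
Qed.

Lemma two_neq0 : (2 : C) != 0. Proof. by rewrite pnatr_eq0. Qed.

(** Exchanging the indices turns twice the sum into the anticommutators contracted with the inverse
    of [eta], that is, twice the trace of the identity matrix. *)
Lemma sum_inv_eta_gamma (B : algType C) (g : 'I_n -> B) : clifford_rel eta g ->
  \sum_i \sum_j invmx eta i j *: (g i * g j) = n%:R.
Proof.
move=> rel; apply: (scalerI two_neq0).
set S := \sum_i _; have -> : 2 *: S = S + S by rewrite scaler_nat mulr2n.
have {2}-> : S = \sum_i \sum_j invmx eta i j *: (g j * g i).
  rewrite exchange_big; apply: eq_bigr => i _; apply: eq_bigr => j _.
  by rewrite inv_eta_symE.
rewrite -big_split /=.
transitivity (\sum_(i < n) (2 : C) *: (1 : B)); last first.
  by rewrite sumr_const card_ord -scalerMnr.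
apply: eq_bigr => i _; rewrite -big_split /=.
transitivity (2 *: \sum_j \sum_k invmx eta i j *: (eta j k *: ((i == k)%:R : B))).
  rewrite scaler_sumr; apply: eq_bigr => j _; rewrite -scalerDr rel.
  rewrite (bigD1 i) //= eqxx big1 ?addr0 => [|k].
    by rewrite !scalerA (eta_symE j i); congr (_ *: _); ring.
  by rewrite eq_sym => /negbTE ->; rewrite !scaler0.
by rewrite (sum_mulmx1 _ _ (mulVmx eta_inv)) eqxx.
Qed.

End CliffordSums.

(** * Word-length filtration of the Clifford algebra and simplicity *)

Section CliffordSimple.
Variables (R : realType) (n : nat).
Local Notation C := (R[i]).
Variable eta : 'M[C]_n.
Hypotheses (eta_sym : eta^T = eta) (eta_inv : eta \in unitmx).
Variables (Cl : algType C) (gam : 'I_n -> Cl).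
Hypothesis hCl : is_clifford_algebra eta gam.

(* Span of the products of fewer than [m] generators. *)
Fixpoint clfilt (m : nat) (a : Cl) : Prop :=
  if m is m'.+1 then exists (c : C) (b : 'I_n -> Cl),
    (forall j, clfilt m' (b j)) /\ a = c%:A + \sum_j gam j * b j
  else a = 0.

Lemma clfilt0 m : clfilt m 0.
Proof.
elim: m => //= m IH; exists 0, (fun=> 0); split=> //.
by rewrite scale0r big1 ?addr0 //= => j _; rewrite mulr0.
Qed.

Lemma clfiltD m a b : clfilt m a -> clfilt m b -> clfilt m (a + b).
Proof.
elim: m a b => [a b -> ->|m IH a b]; first by rewrite /= addr0.
move=> [c1 [b1 [h1 ->]]] [c2 [b2 [h2 ->]]].
exists (c1 + c2), (fun j => b1 j + b2 j); split=> [j|].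
  exact: IH _ _ (h1 j) (h2 j).
rewrite scalerDl addrACA -big_split /=; congr (_ + _).
by apply: eq_bigr => j _; rewrite mulrDr.
Qed.

Lemma clfiltZ m (c : C) a : clfilt m a -> clfilt m (c *: a).
Proof.
elim: m a => [a -> | m IH a]; first by rewrite /= scaler0.
move=> [c1 [b1 [h1 ->]]]; exists (c * c1), (fun j => c *: b1 j); split=> [j|].
  exact: IH _ (h1 j).
rewrite scalerDr scalerA scaler_sumr; congr (_ + _).
by apply: eq_bigr => j _; rewrite scalerAr.
Qed.

Lemma clfiltN m a : clfilt m a -> clfilt m (- a).
Proof. by move=> h; rewrite -scaleN1r; apply: clfiltZ. Qed.

Lemma clfiltB m a b : clfilt m a -> clfilt m b -> clfilt m (a - b).
Proof. by move=> ha hb; apply: clfiltD => //; apply: clfiltN. Qed.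

Lemma clfilt_sum m I (r : seq I) (P : pred I) (F : I -> Cl) :
  (forall i, clfilt m (F i)) -> clfilt m (\sum_(i <- r | P i) F i).
Proof.
by move=> h; apply: big_ind => //; [exact: clfilt0 | exact: clfiltD].
Qed.

Lemma clfilt_scalar m (c : C) : clfilt m.+1 c%:A.
Proof.
exists c, (fun=> 0); split=> [j|]; first exact: clfilt0.
by rewrite big1 ?addr0 //= => j _; rewrite mulr0.
Qed.

Lemma clfilt1 m : clfilt m.+1 1.
Proof. by rewrite -(scale1r (1 : Cl)); apply: clfilt_scalar. Qed.

Lemma clfilt_le m p a : (m <= p)%N -> clfilt m a -> clfilt p a.
Proof.
elim: m p a => [p a _ ->|m IH [|p] a // lemp]; first exact: clfilt0.
by move=> [c [b [hb ->]]]; exists c, b; split=> // j; exact: IH _ _ lemp (hb j).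
Qed.

Lemma clfilt_gaml m j a : clfilt m a -> clfilt m.+1 (gam j * a).
Proof.
move=> ha; exists 0, (fun k => (j == k)%:R *: a); split=> [k|].
  exact: clfiltZ.
rewrite scale0r add0r (bigD1 j) //= eqxx scale1r big1 ?addr0 // => k.
by rewrite eq_sym => /negbTE ->; rewrite scale0r mulr0.
Qed.

Lemma clfilt_gamr m j a : clfilt m a -> clfilt m.+1 (a * gam j).
Proof.
elim: m a => [a ->|m IH a]; first by rewrite mul0r; apply: clfilt0.
move=> [c [b [hb ->]]]; rewrite mulrDl mulr_suml; apply: clfiltD.
  by rewrite -scalerAl mul1r -[gam j]mulr1; exact/clfiltZ/clfilt_gaml/clfilt1.
by apply: clfilt_sum => k; rewrite -mulrA; exact/clfilt_gaml/IH/hb.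
Qed.

Lemma clfiltM m p a b : clfilt m a -> clfilt p b -> clfilt (m + p) (a * b).
Proof.
elim: m a => [a ->|m IH a]; first by rewrite mul0r => _; apply: clfilt0.
move=> [c [f [hf ->]]] hb; rewrite mulrDl mulr_suml; apply: clfiltD.
  rewrite -scalerAl mul1r; apply: clfiltZ; apply: clfilt_le hb; exact: leq_addl.
by apply: clfilt_sum => k; rewrite -mulrA addSn; exact/clfilt_gaml/(IH _ (hf k)).
Qed.

Lemma clfilt_exhaust a : exists m, clfilt m a.
Proof.
apply: (clifford_ind (P := fun a => exists m, clfilt m a) hCl).
  split=> [|{}a b [m ha] [p hb]|{}a b [m ha] [p hb]|c {}a [m ha]].
  - by exists 1%N; apply: clfilt1.
  - exists (m + p)%N; apply: clfiltD.
      by apply: clfilt_le ha; apply: leq_addr.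
    by apply: clfilt_le hb; apply: leq_addl.
  - by exists (m + p)%N; apply: clfiltM.
  - by exists m; apply: clfiltZ.
by move=> i; exists 2%N; rewrite -[gam i]mulr1; apply: (@clfilt_gaml 1); apply: clfilt1.
Qed.

(** The relations are quadratic, so the negated generators satisfy them too. *)
Lemma parity_morph :
  exists al : Cl -> Cl, is_alg_morph al /\ forall i, al (gam i) = - gam i.
Proof.
have [rel univ] := hCl.
have rel' : clifford_rel eta (fun i => - gam i).
  by move=> i j; rewrite !mulrNN rel.
by have [[al ?] _] := univ _ _ rel'; exists al.
Qed.

(** * Leading terms of the parity automorphism and of the Casimir operator *)

Section Symbols.
Variable al : Cl -> Cl.
Hypotheses (alM : is_alg_morph al) (al_gam : forall i, al (gam i) = - gam i).

Let alD a b : al (a + b) = al a + al b. Proof. exact: alM.1. Qed.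
Let alMul a b : al (a * b) = al a * al b. Proof. exact: alM.2.1. Qed.
Let al1 : al 1 = 1. Proof. exact: alM.2.2.1. Qed.
Let alZ c a : al (c *: a) = c *: al a. Proof. exact: alM.2.2.2. Qed.
Let al0 : al 0 = 0. Proof. by apply: (addrI (al 0)); rewrite -alD !addr0. Qed.
Let al_sum (F : 'I_n -> Cl) : al (\sum_j F j) = \sum_j al (F j).
Proof. exact: (big_morph al alD al0). Qed.

(** Level [m.+1] has top degree [m], and [al] multiplies a product of [m] generators by
    [(-1) ^+ m]. *)
Lemma parity_symbol m a : clfilt m.+1 a -> clfilt m (al a - (-1) ^+ m *: a).
Proof.
elim: m a => [|m IH] a [c [b [hb ->]]].
  by rewrite expr0 scale1r big1 => [|j _]; rewrite ?hb ?mulr0 // addr0 alZ al1 subrr.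
rewrite alD alZ al1 al_sum scalerDr opprD addrACA; apply: clfiltD.
  by apply: clfiltB; [|apply: clfiltZ]; apply: clfilt_scalar.
rewrite scaler_sumr -sumrB; apply: clfilt_sum => j.
have -> : al (gam j * b j) - (-1) ^+ m.+1 *: (gam j * b j) =
  - (gam j * (al (b j) - (-1) ^+ m *: b j)).
  rewrite alMul al_gam exprS mulN1r scaleNr opprK mulNr mulrBr opprB.
  by rewrite -scalerAr addrC.
exact/clfiltN/clfilt_gaml/IH/hb.
Qed.

(* [gam k * a - al a * gam k] is twice a contraction of [a], hence lowers the filtration. *)
Lemma supercommutator_filt m k a :
  clfilt m.+1 a -> clfilt m (gam k * a - al a * gam k).
Proof.
have [rel _] := hCl.
elim: m a => [|m IH] a [c [b [hb ->]]].
  rewrite big1 => [|j _]; rewrite ?hb ?mulr0 // addr0 alZ al1.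
  by rewrite -scalerAr -scalerAl mul1r mulr1 subrr.
rewrite alD alZ al1 al_sum mulrDr mulrDl opprD addrACA; apply: clfiltD.
  by rewrite -scalerAr -scalerAl mul1r mulr1 subrr; apply: clfilt0.
rewrite mulr_sumr mulr_suml -sumrB; apply: clfilt_sum => j.
have -> : gam k * (gam j * b j) - al (gam j * b j) * gam k =
  (2 * eta k j) *: b j - gam j * (gam k * b j - al (b j) * gam k).
  rewrite alMul al_gam !mulNr opprK mulrBr opprB !mulrA.
  have -> : gam k * gam j = (2 * eta k j)%:A - gam j * gam k by rewrite -rel addrK.
  by rewrite mulrBl -scalerAl mul1r -addrA [- _ + _]addrC.
by apply: clfiltB; [apply: clfiltZ | apply/clfilt_gaml/IH].
Qed.

Definition casimir (a : Cl) : Cl :=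
  \sum_i \sum_j invmx eta i j *: (gam i * a * gam j).

Lemma casimirD a b : casimir (a + b) = casimir a + casimir b.
Proof.
rewrite -big_split /=; apply: eq_bigr => i _; rewrite -big_split /=.
by apply: eq_bigr => j _; rewrite mulrDr mulrDl scalerDr.
Qed.

Lemma casimirZ c a : casimir (c *: a) = c *: casimir a.
Proof.
rewrite scaler_sumr; apply: eq_bigr => i _; rewrite scaler_sumr.
by apply: eq_bigr => j _; rewrite -scalerAr -scalerAl !scalerA mulrC.
Qed.

Lemma casimir1 : casimir 1 = n%:R.
Proof.
rewrite /casimir -(sum_inv_eta_gamma eta_sym eta_inv hCl.1).
by apply: eq_bigr => i _; apply: eq_bigr => j _; rewrite mulr1.
Qed.

(** Anticommuting [gam j] to the front past each [gam k] leaves the term [2 * eta j k], which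
    cancels against the inverse of [eta] in the contraction. *)
Lemma casimir_gaml j b :
  casimir (gam j * b) = 2 *: (b * gam j) - gam j * casimir b.
Proof.
have [rel _] := hCl.
(* Expanding [b * gam j] as a contraction puts both sides under the same double sum, to be compared
   termwise. *)
rewrite -[b * gam j](sum_mulmx1 (fun l => b * gam l) j (mulmxV eta_inv)).
rewrite scaler_sumr mulr_sumr -sumrB; apply: eq_bigr => k _.
rewrite scaler_sumr mulr_sumr -sumrB; apply: eq_bigr => l _.
have -> : gam k * (gam j * b) = (2 * eta j k) *: b - gam j * (gam k * b).
  rewrite !mulrA (eta_symE eta_sym).
  have -> : gam k * gam j = (2 * eta k j)%:A - gam j * gam k by rewrite -rel addrK.
  by rewrite mulrBl -scalerAl mul1r.
rewrite mulrBl scalerBr -scalerAl -mulrA -scalerAr; congr (_ - _); last by rewrite !mulrA.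
by rewrite !scalerA; congr (_ *: _); ring.
Qed.

Lemma casimir_sum (F : 'I_n -> Cl) : casimir (\sum_j F j) = \sum_j casimir (F j).
Proof.
apply: (big_morph casimir casimirD).
by rewrite -[X in casimir X](scale0r (0 : Cl)) casimirZ scale0r.
Qed.

(** Modulo lower terms, [b] may be replaced by [(-1) ^+ m *: al b], and [al b * gam j] by
    [gam j * b]; these are the two preceding filtration estimates. *)
Lemma gam_commutation_filt m j b : clfilt m.+1 b ->
  clfilt m.+1 (b * gam j - (-1) ^+ m *: (gam j * b)).
Proof.
move=> hb.
have -> : b * gam j - (-1) ^+ m *: (gam j * b) =
    (-1) ^+ m.+1 *: ((al b - (-1) ^+ m *: b) * gam j + (gam j * b - al b * gam j)).
  rewrite mulrBl addrCA [al b * _ - _ - _]addrAC subrr sub0r -scalerAl scalerBr scalerA.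
  by rewrite exprS mulN1r mulNr -expr2 sqrr_sign !scaleNr opprK scale1r addrC.
apply: clfiltZ; apply: clfiltD.
  exact/clfilt_gamr/parity_symbol.
by apply: (@clfilt_le m) => //; apply: supercommutator_filt.
Qed.

Definition casimir_eig (m : nat) : C := (-1) ^+ m * (n%:R - m%:R *+ 2).

(** Peeling off one generator with [casimir_gaml] gives eigenvalues [e] with
    [e (m + 1) = 2 (-1)^m - e m] and [e 0 = n], whose solution is [casimir_eig]. *)
Lemma casimir_symbol m a :
  clfilt m.+1 a -> clfilt m (casimir a - casimir_eig m *: a).
Proof.
elim: m a => [|m IH] a [c [b [hb ->]]].
  rewrite big1 => [|j _]; rewrite ?hb ?mulr0 // addr0 casimirZ casimir1.
  rewrite /casimir_eig expr0 mul1r mul0rn subr0 scalerA mulrC -scalerA scaler_nat.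
  by rewrite subrr.
rewrite casimirD casimirZ casimir1 casimir_sum scalerDr opprD addrACA; apply: clfiltD.
  apply: clfiltB; last by apply: clfiltZ; apply: clfilt_scalar.
  by rewrite -[n%:R]scaler_nat; apply: clfiltZ; apply: clfilt_scalar.
rewrite scaler_sumr -sumrB; apply: clfilt_sum => j.
have -> : casimir (gam j * b j) - casimir_eig m.+1 *: (gam j * b j) =
    2 *: (b j * gam j - (-1) ^+ m *: (gam j * b j))
    - gam j * (casimir (b j) - casimir_eig m *: b j).
  have -> : casimir_eig m.+1 = 2 * (-1) ^+ m - casimir_eig m.
    by rewrite /casimir_eig exprS; ring.
  rewrite casimir_gaml mulrBr scalerBl scalerBr -scalerAr !scalerA !opprB.
  by rewrite addrACA [- _ + _]addrC [RHS]addrACA [_ - gam j * _]addrC addrACA.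
apply: clfiltB.
  exact/clfiltZ/gam_commutation_filt.
exact/clfilt_gaml/IH/hb.
Qed.

Lemma casimir_parity a : casimir (al a) = al (casimir a).
Proof.
rewrite al_sum; apply: eq_bigr => i _; rewrite al_sum; apply: eq_bigr => j _.
by rewrite alZ !alMul !al_gam mulrN !mulNr opprK.
Qed.

(** Degrees of equal parity are separated by [n - 2 m]. For opposite parities, equality would force
    [n = m + p], which is odd. *)
Lemma casimir_eig_inj : ~~ odd n -> injective casimir_eig.
Proof.
move=> even_n m p; rewrite /casimir_eig -!(signr_odd _ m) -!(signr_odd _ p).
have s0 (b : bool) : (-1) ^+ b != 0 :> C by rewrite signr_eq0.
have two_inj (u v : nat) : u.*2%:R = v.*2%:R :> C -> u = v.
  by move/eqP; rewrite eqr_nat => /eqP /double_inj.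
have [->|neq] := eqVneq (odd m) (odd p).
  move/(mulfI (s0 _))/addrI/oppr_inj.
  by rewrite -!mulrnA !muln2 => /two_inj.
have -> : odd m = ~~ odd p by case: (odd m) (odd p) neq => [] [].
rewrite signrN mulNr -mulrN => /(mulfI (s0 _)) h.
suff npE : n = (m + p)%N.
  by move: even_n; rewrite npE oddD; case: (odd m) (odd p) neq => [] [].
apply: two_inj; rewrite -!muln2 !natrM natrD.
transitivity (n%:R - p%:R *+ 2 + (n%:R + p%:R *+ 2) : C); first by ring.
by rewrite -h; ring.
Qed.

(** If [b] has top degree [p < m], then [casimir b - casimir_eig p *: b] is a nonzero multiple of
    [b] lying one level lower; the descent ends at level 0. *)
Lemma casimir_eig_filt m b : ~~ odd n ->
  clfilt m b -> casimir b = casimir_eig m *: b -> b = 0.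
Proof.
move=> even_n hb cb.
have low p : (p <= m)%N -> clfilt p b -> b = 0.
  elim: p => [|p IH] lepm // hp; apply: IH; first exact: ltnW.
  have /(clfiltZ (casimir_eig m - casimir_eig p)^-1) := casimir_symbol hp.
  rewrite cb -scalerBl scalerA mulVf ?scale1r // subr_eq0.
  by apply: contraTneq lepm => /(casimir_eig_inj even_n) ->; rewrite ltnn.
exact: low hb.
Qed.

End Symbols.

Lemma clifford_simple (J : Cl -> Prop) a : ~~ odd n ->
  reg_subrep J -> J a -> a <> 0 -> J 1.
Proof.
move=> even_n [J0 [JD [Jl Jr]]] + a0.
have [al [alM al_gam]] := parity_morph.
have JZ (c : C) u : J u -> J (c *: u).
  by move=> Ju; rewrite -[u]mul1r scalerAl; apply: Jl.
have JB u v : J u -> J v -> J (u - v).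
  by move=> Ju Jv; rewrite -scaleN1r; apply/JD/JZ.
have [m] := clfilt_exhaust a.
elim: m a a0 => [a a0 /a0 //|m IH a a0 am Ja].
(* Excluded middle reduces to [a] of minimal level: [J] then has no nonzero element in level [m]. *)
have [[b [[b0 bm] Jb]]|noJ] := EM (exists b, (b <> 0 /\ clfilt m b) /\ J b).
  exact: IH b0 bm Jb.
have J_low b : clfilt m b -> J b -> b = 0.
  move=> bm Jb; have [//|b0] := EM (b = 0).
  by case: noJ; exists b.
have Jcas : J (casimir a).
  apply: big_ind => // i _; apply: big_ind => // j _.
  exact/JZ/Jr/Jl.
have cas_a : casimir a = casimir_eig m *: a.
  apply/eqP; rewrite -subr_eq0; apply/eqP; apply: J_low.
    exact: (casimir_symbol alM al_gam am).
  exact/JB/JZ.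
(* [J] is not known to be stable under [al], so minimality cannot be applied here. Instead the
   difference is an eigenvector for [casimir_eig m] in level [m], hence zero. *)
have al_a : al a = (-1) ^+ m *: a.
  apply/eqP; rewrite -subr_eq0; apply/eqP.
  apply: (casimir_eig_filt alM al_gam (m := m)) => //; first exact: parity_symbol.
  rewrite casimirD -scaleNr casimirZ (casimir_parity alM al_gam) cas_a.
  by rewrite alM.2.2.2 scalerDr !scalerA mulrC.
have comm_a k : a * gam k = (-1) ^+ m *: (gam k * a).
  have /J_low : clfilt m (gam k * a - al a * gam k).
    exact: supercommutator_filt.
  rewrite al_a -scalerAl => /(_ (JB _ _ (Jl _ _ Ja) (JZ _ _ (Jr _ _ Ja)))) /eqP.
  by rewrite subr_eq0 => /eqP ->; rewrite scalerA -expr2 sqrr_sign scale1r.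
(* Since [a] commutes with generators up to sign, it factors out of the Casimir sum. Comparing this
   eigenvalue with [(-1)^m (n - 2 m)] forces [m = 0], and level 1 consists of scalars. *)
have : casimir a = ((-1) ^+ m * n%:R) *: a.
  transitivity ((-1) ^+ m *: (casimir 1 * a)); last first.
    by rewrite casimir1 -[n%:R]scaler_nat -scalerAl mul1r scalerA.
  rewrite /casimir mulr_suml scaler_sumr; apply: eq_bigr => i _.
  rewrite mulr_suml scaler_sumr; apply: eq_bigr => j _.
  rewrite mulr1 -mulrA comm_a -scalerAr -scalerAl !scalerA mulrC; congr (_ *: _).
  by rewrite mulrA.
move/eqP; rewrite cas_a -subr_eq0 -scalerBl scaler_eq0 => /orP [|/eqP //].
rewrite /casimir_eig -mulrBr mulf_eq0 signr_eq0 /= addrAC subrr sub0r oppr_eq0.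
rewrite -mulrnA pnatr_eq0 muln_eq0 orbF => /eqP m0.
have [c [b [hb aE]]] : clfilt 1 a by rewrite -m0.
have {}aE : a = c%:A.
  by rewrite aE big1 ?addr0 // => j _; rewrite hb mulr0.
have c0 : c != 0 by apply/eqP => c0; apply: a0; rewrite aE c0 scale0r.
by rewrite -(scale1r 1) -(mulVf c0) -scalerA -aE; apply: JZ.
Qed.

End CliffordSimple.

(** * Elements of the normalizer *)

Section NoncommutativeIdentities.
(* Imported only here, since its notations shadow those of MathComp. *)
Import Ncring Ncring_tac.
Local Open Scope ring_scope.
Variable A : nzRingType.

#[local] Instance nzring_ops : @Ring_ops A 0 1 (@GRing.add A) (@GRing.mul A)
  (fun a b => a - b) (@GRing.opp A) (@eq A) := {}.

#[local] Instance nzring_ncring : @Ncring.Ring A 0 1 (@GRing.add A)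
  (@GRing.mul A) (fun a b => a - b) (@GRing.opp A) (@eq A) nzring_ops.
Proof.
constructor; rewrite /addition /add_notation /multiplication /mul_notation
  /zero /zero_notation /one /one_notation /subtraction /sub_notation
  /opposite /opp_notation /equality /eq_notation /=.
- exact: RelationClasses.eq_equivalence.
- by move=> ? ? -> ? ? ->.
- by move=> ? ? -> ? ? ->.
- by move=> ? ? -> ? ? ->.
- by move=> ? ? ->.
- exact: add0r.
- exact: addrC.
- exact: addrA.
- exact: mul1r.
- exact: mulr1.
- exact: mulrA.
- by move=> *; apply: mulrDl.
- by move=> *; apply: mulrDr.
- by [].
- exact: subrr.
Qed.

Variables D M H x g p : A.
Hypotheses (DH : D * H = H * D + (D + D)) (Dx : D * x = x * D + g)
  (Dg : D * g = p + p - g * D) (DM : D * M = H - M * D)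
  (pH : p * H = H * p + (p + p)) (HM : H * M = M * H + (M + M))
  (gH : g * H = H * g) (Dp : D * p = p * D).

(** Abstract form of [dirac_raising]: the letters [D], [M], [H], [x], [g], [p] stand for [dirac],
    [slash_x], [weight], [x i], [g i], [d_up i]. *)
Lemma raising_comm : D * (x * H - M * g - M * M * p) =
  (x * H - M * g - M * M * p + (x + x)) * D.
Proof.
apply/eqP; rewrite -subr_eq0; apply/eqP.
(* The difference of the two sides is a noncommutative combination of the defects of the assumed
   relations, each of which vanishes. *)
transitivity ((D * x - (x * D + g)) * H + x * (D * H - (H * D + (D + D)))
  + (g * H - H * g) - (D * M - (H - M * D)) * g
  + M * (D * g - (p + p - g * D)) - (D * M - (H - M * D)) * M * p
  + M * (D * M - (H - M * D)) * p - M * M * (D * p - p * D)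
  - (H * M - (M * H + (M + M))) * p).
  by non_commutative_ring.
by rewrite Dx DH gH DM Dg Dp HM !subrr; non_commutative_ring.
Qed.

Lemma rotation_comm : D * (g * (H - 1 - 1) - M * p - M * p) =
  (M * p + M * p - g * H) * D.
Proof.
apply/eqP; rewrite -subr_eq0; apply/eqP.
transitivity ((D * g - (p + p - g * D)) * (H - 1 - 1)
  + (p * H - (H * p + (p + p))) + (p * H - (H * p + (p + p)))
  - g * (D * H - (H * D + (D + D)))
  - (D * M - (H - M * D)) * p - (D * M - (H - M * D)) * p
  + M * (D * p - p * D) + M * (D * p - p * D)).
  by non_commutative_ring.
by rewrite DH DM Dg Dp pH !subrr; non_commutative_ring.
Qed.

End NoncommutativeIdentities.

(** * Relations of the Dirac operator in the Weyl-Clifford algebra, and the normalizer *)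

Section Normalizer.
Variables (R : realType) (n : nat).
Local Notation C := (R[i]).
Variable eta : 'M[C]_n.
Hypotheses (eta_sym : eta^T = eta) (eta_inv : eta \in unitmx).
Variables (A : algType C) (x d g : 'I_n -> A).
Hypothesis rel : weyl_clifford_rel eta x d g.

(** The overview's [D], [M], [H] and [d^i] are [dirac], [slash_x], [weight] and [d_up i]. Of the two
    families built from them, [rotation] preserves the polynomial degree and [raising] increases it
    by one. *)
Definition dirac : A := \sum_i g i * d i.
Definition euler : A := \sum_i x i * d i.
Definition slash_x : A := \sum_i \sum_j invmx eta i j *: (x i * g j).
Definition d_up (i : 'I_n) : A := \sum_j eta i j *: d j.
Definition weight : A := n%:R + euler + euler.
Definition rotation (i : 'I_n) : A :=
  g i * (weight - 1 - 1) - slash_x * d_up i - slash_x * d_up i.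
Definition raising (i : 'I_n) : A :=
  x i * weight - slash_x * g i - slash_x * slash_x * d_up i.

Let xx i j : x i * x j = x j * x i. Proof. exact: rel.1. Qed.
Let dd i j : d i * d j = d j * d i. Proof. exact: rel.2.1. Qed.
Let dx i j : d i * x j = x j * d i + (i == j)%:R.
Proof. by rewrite -rel.2.2.1 addrC subrK. Qed.
Let gx i j : g i * x j = x j * g i. Proof. exact: rel.2.2.2.1. Qed.
Let gd i j : g i * d j = d j * g i. Proof. exact: rel.2.2.2.2.1. Qed.
Let gg : clifford_rel eta g. Proof. exact: rel.2.2.2.2.2. Qed.

Let sum_delta (f : 'I_n -> A) i : \sum_j f j * (j == i)%:R = f i.
Proof.
rewrite (bigD1 i) //= eqxx mulr1 big1 ?addr0 // => j /negbTE ->.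
by rewrite mulr0.
Qed.

Lemma d_dirac i : d i * dirac = dirac * d i.
Proof.
rewrite mulr_sumr mulr_suml; apply: eq_bigr => j _.
by rewrite mulrA -gd -!mulrA dd.
Qed.

Lemma dirac_d_up i : dirac * d_up i = d_up i * dirac.
Proof.
rewrite mulr_sumr mulr_suml; apply: eq_bigr => j _.
by rewrite -scalerAr -scalerAl d_dirac.
Qed.

Lemma dirac_x i : dirac * x i = x i * dirac + g i.
Proof.
rewrite mulr_suml mulr_sumr -[g i]sum_delta -big_split /=.
by apply: eq_bigr => j _; rewrite -mulrA dx mulrDr !mulrA gx.
Qed.

Lemma dirac_g i : dirac * g i = d_up i + d_up i - g i * dirac.
Proof.
rewrite mulr_suml mulr_sumr -big_split -sumrB /=; apply: eq_bigr => j _.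
rewrite -mulrA -gd !mulrA.
have -> : g j * g i = (2 * eta i j)%:A - g i * g j by rewrite -gg addrC addKr.
by rewrite mulrBl -scalerAl mul1r -scalerA scaler_nat mulr2n.
Qed.

Lemma d_euler i : d i * euler = euler * d i + d i.
Proof.
rewrite mulr_sumr mulr_suml -[X in _ = _ + X]sum_delta -big_split /=.
apply: eq_bigr => j _; rewrite mulrA dx mulrDl -!mulrA dd; congr (_ + _).
by rewrite eq_sym; case: eqP; rewrite ?mul1r ?mulr1 ?mul0r ?mulr0.
Qed.

Lemma euler_x i : euler * x i = x i * euler + x i.
Proof.
rewrite mulr_suml mulr_sumr -[X in _ = _ + X]sum_delta -big_split /=.
by apply: eq_bigr => j _; rewrite -mulrA dx mulrDr !mulrA xx.
Qed.

Lemma g_euler i : g i * euler = euler * g i.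
Proof.
rewrite mulr_sumr mulr_suml; apply: eq_bigr => j _.
by rewrite mulrA gx -!mulrA gd.
Qed.

Lemma g_weight i : g i * weight = weight * g i.
Proof. by rewrite !mulrDr !mulrDl g_euler -(commr_nat (g i) n). Qed.

Lemma d_weight i : d i * weight = weight * d i + (d i + d i).
Proof.
by rewrite !mulrDr !mulrDl d_euler -(commr_nat (d i) n) -!addrA [d i + (_ + _)]addrCA.
Qed.

Lemma d_up_weight i : d_up i * weight = weight * d_up i + (d_up i + d_up i).
Proof.
rewrite mulr_suml mulr_sumr -!big_split /=; apply: eq_bigr => j _.
by rewrite -scalerAl d_weight -scalerAr !scalerDr.
Qed.

Lemma dirac_euler : dirac * euler = euler * dirac + dirac.
Proof.
rewrite mulr_suml mulr_sumr -big_split /=; apply: eq_bigr => i _.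
by rewrite -mulrA d_euler mulrDr !mulrA g_euler.
Qed.

Lemma dirac_weight : dirac * weight = weight * dirac + (dirac + dirac).
Proof.
rewrite mulr_suml mulr_sumr -!big_split /=; apply: eq_bigr => i _.
by rewrite -mulrA d_weight !mulrDr !mulrA g_weight.
Qed.

Lemma weight_slash_x : weight * slash_x = slash_x * weight + (slash_x + slash_x).
Proof.
have euler_slash : euler * slash_x = slash_x * euler + slash_x.
  rewrite [euler * _]mulr_sumr [slash_x * _]mulr_suml -big_split /=.
  apply: eq_bigr => i _; rewrite [euler * _]mulr_sumr mulr_suml -big_split /=.
  apply: eq_bigr => j _.
  rewrite -scalerAr -scalerAl mulrA euler_x mulrDl scalerDr.
  by rewrite -!mulrA g_euler.
rewrite !mulrDr !mulrDl euler_slash (commr_nat slash_x n) -!addrA.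
by rewrite [slash_x + (_ + _)]addrCA.
Qed.

(** Passing [x i] leaves [g i], which contracts with [g j] to [n]; passing [g j] leaves [2 d^j],
    which contracts with [x i] to twice [euler]. *)
Lemma dirac_slash_x : dirac * slash_x = weight - slash_x * dirac.
Proof.
have -> : dirac * slash_x =
  \sum_i \sum_j (invmx eta i j *: (x i * (d_up j + d_up j))
   + invmx eta i j *: (g i * g j) - invmx eta i j *: (x i * g j * dirac)).
  rewrite mulr_sumr; apply: eq_bigr => i _.
  rewrite mulr_sumr; apply: eq_bigr => j _.
  rewrite -scalerAr -scalerDr -scalerBr; congr (_ *: _).
  rewrite mulrA dirac_x mulrDl -(mulrA (x i) dirac) dirac_g mulrBr (mulrA (x i) (g j)).
  by rewrite addrAC.
under eq_bigr do rewrite sumrB big_split /=.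
rewrite sumrB big_split /= (sum_inv_eta_gamma eta_sym eta_inv gg).
congr (_ - _); last first.
  rewrite mulr_suml; apply: eq_bigr => i _; rewrite mulr_suml.
  by apply: eq_bigr => j _; rewrite -scalerAl.
rewrite addrC /weight -addrA; congr (_ + _); rewrite -big_split /=.
apply: eq_bigr => i _.
rewrite -mulrDr -(sum_mulmx1 d i (mulVmx eta_inv)) -big_split mulr_sumr /=.
by apply: eq_bigr => j _; rewrite scalerAr scalerDr /d_up !scaler_sumr.
Qed.

Lemma dirac_rotation i : exists p, dirac * rotation i = p * dirac.
Proof.
(* The left cofactor is read off by unification with the abstract identity. *)
eexists; apply: rotation_comm.
- exact: dirac_weight.
- exact: dirac_g.
- exact: dirac_slash_x.
- exact: d_up_weight.
- exact: dirac_d_up.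
Qed.

Lemma dirac_raising i : exists p, dirac * raising i = p * dirac.
Proof.
eexists; apply: raising_comm.
- exact: dirac_weight.
- exact: dirac_x.
- exact: dirac_g.
- exact: dirac_slash_x.
- exact: weight_slash_x.
- exact: g_weight.
- exact: dirac_d_up.
Qed.

(** The anticommutator of [dirac] with each summand [g i * d i] is [2 d^i d_i]; summing over [i]
    gives twice the square. *)
Lemma sum_d_up_d : \sum_i d_up i * d i = dirac * dirac.
Proof.
apply: (scalerI (two_neq0 R)).
set S := \sum_i _ * d i; have -> : 2 *: (dirac * dirac) = dirac * dirac + dirac * dirac.
  by rewrite scaler_nat mulr2n.
have dE i : dirac * (g i * d i) + (g i * d i) * dirac = 2 *: (d_up i * d i).
  rewrite mulrA dirac_g mulrBl -!mulrA d_dirac subrK scalerAl.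
  by rewrite scaler_nat mulr2n.
have sl : dirac * dirac = \sum_i dirac * (g i * d i) by rewrite -mulr_sumr.
have sr : dirac * dirac = \sum_i g i * d i * dirac by rewrite -mulr_suml.
rewrite {1}sl sr -big_split scaler_sumr /=.
by apply: eq_bigr => i _; rewrite dE.
Qed.

Lemma sum_raising_d : exists p,
  \sum_i raising i * d i = euler * (weight - 1 - 1) - p * dirac.
Proof.
(* The second and third terms of [raising] sum to [M D] and [M^2 D^2]. In the first,
   [H d_i = d_i (H - 2)]. *)
exists (slash_x + slash_x * slash_x * dirac).
rewrite mulrDl opprD addrA -[_ * dirac * dirac]mulrA -sum_d_up_d mulr_sumr.
rewrite {1}/dirac mulr_sumr mulr_suml -!sumrB; apply: eq_bigr => i _.
rewrite !mulrBl -!mulrA; congr (_ - _ - _).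
by congr (_ * _); rewrite -addrA -opprD mulrBr d_weight mulrDr mulr1 addrK.
Qed.

Lemma Xel_dirac : Xel d g = ('i / sqrtC 2) *: dirac. Proof. by []. Qed.

Lemma Xel_scalar_neq0 : 'i / sqrtC 2 != 0 :> C.
Proof. by rewrite mulf_neq0 ?neq0Ci // invr_neq0 // sqrtC_eq0 two_neq0. Qed.

Lemma Eel_dirac : Eel eta d = - (1 / 2 : C) *: (dirac * dirac).
Proof.
rewrite -sum_d_up_d /Eel; congr (_ *: _); apply: eq_bigr => i _.
by rewrite mulr_suml; apply: eq_bigr => j _; rewrite scalerAl.
Qed.

(** [Xel] is a nonzero multiple of [dirac] and [Eel] a multiple of its square, so the left ideal is
    principal. *)
Lemma IidealP a : Iideal eta d g a <-> exists p, a = p * dirac.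
Proof.
split=> [[b [c ->]]|[p ->]].
  rewrite Xel_dirac Eel_dirac -!scalerAr mulrA !scalerAl -mulrDl.
  by eexists.
exists (('i / sqrtC 2)^-1 *: p), 0; rewrite mul0r addr0 Xel_dirac.
by rewrite -scalerAl -scalerAr scalerA mulVf ?scale1r // Xel_scalar_neq0.
Qed.

Lemma NormIP a : NormI eta d g a <-> exists p, dirac * a = p * dirac.
Proof.
split=> [Na|[p e] b /IidealP [q ->]].
  by apply/IidealP/Na/IidealP; exists 1; rewrite mul1r.
by apply/IidealP; exists (q * p); rewrite -mulrA e mulrA.
Qed.

Lemma NormI_d i : NormI eta d g (d i).
Proof. by apply/NormIP; exists (d i); rewrite d_dirac. Qed.

Lemma NormI_euler : NormI eta d g euler.
Proof. by apply/NormIP; exists (euler + 1); rewrite dirac_euler mulrDl mul1r. Qed.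

Lemma NormI_rotation i : NormI eta d g (rotation i).
Proof. exact/NormIP/dirac_rotation. Qed.

Lemma NormI_raising i : NormI eta d g (raising i).
Proof. exact/NormIP/dirac_raising. Qed.

End Normalizer.

(** * Subrepresentations of the solution space *)

(** Applying [m - T] to the sum kills the top component [u m] and multiplies each other [u k] by the
    positive integer [m - k], which can be divided out; then induct. *)
Lemma eigen_component (V : zmodType) (T : V -> V) (P : V -> Prop) :
  (forall u v, T (u + v) = T u + T v) ->
  (forall u v, P u -> P v -> P (u + v)) -> (forall u, P u -> P (- u)) ->
  (forall u k, P (u *+ k.+1) -> P u) -> (forall u, P u -> P (T u)) ->
  forall m (u : nat -> V), (forall k, T (u k) = u k *+ k) ->
    P (\sum_(k < m) u k) -> forall k, (k < m)%N -> P (u k).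
Proof.
move=> TD PD PN Pdiv PT; elim=> [//|m IH] u Tu Psum.
have P0 : P 0 by rewrite -(subrr (\sum_(k < m.+1) u k)); apply/PD/PN.
have PMn v k : P v -> P (v *+ k).
  by move=> Pv; elim: k => [|k IHk]; rewrite ?mulr0n // mulrS; apply: PD.
have T0 : T 0 = 0 by apply: (addrI (T 0)); rewrite -TD !addr0.
have TMn v k : T (v *+ k) = T v *+ k.
  by elim: k => [|k IHk]; rewrite ?mulr0n // !mulrS TD IHk.
have Plow k : (k < m)%N -> P (u k).
  move=> ltkm; have := subn_gt0 k m; rewrite ltkm => lt0.
  apply: (Pdiv _ (m - k).-1); rewrite prednK //.
  apply: (IH (fun k => u k *+ (m - k))) => //.
    by move=> l; rewrite TMn Tu -!mulrnA mulnC.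
  have -> : \sum_(l < m) u l *+ (m - l) =
      (\sum_(l < m.+1) u l) *+ m - T (\sum_(l < m.+1) u l).
    rewrite (big_morph T TD T0) -sumrMnl -sumrB big_ord_recr /= Tu subrr addr0.
    by apply: eq_bigr => l _; rewrite Tu mulrnBr // ltnW.
  exact/PD/PN/PT/Psum/PMn.
move=> k; rewrite ltnS leq_eqVlt => /orP [/eqP ->|]; last exact: Plow.
have -> : u m = \sum_(l < m.+1) u l - \sum_(l < m) u l.
  by rewrite big_ord_recr /= addrAC subrr add0r.
by apply/PD/PN => //; apply: big_ind => // l _; apply: Plow.
Qed.

(** * Homogeneous polynomials over a noncommutative ring *)

Section HomogeneousPolynomials.
Variables (n : nat) (B : nzRingType).
Implicit Types v : {mpoly B[n]}.

Lemma mderiv_homog i k v : v \is k.+1.-homog -> v^`M(i) \is k.-homog.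
Proof.
move=> /dhomogP hom; apply/dhomogP => m; rewrite mcoeff_msupp mcoeff_deriv => nz.
have : (m + U_(i))%MM \in msupp v.
  by rewrite mcoeff_msupp; apply: contraNneq nz => ->; rewrite mul0rn.
by move/hom => /=; rewrite mdegD mdeg1 addn1 => -[].
Qed.

Lemma homog0_const v : v \is 0.-homog -> v = (v@_0%MM)%:MP.
Proof.
move=> /dhomogP hom; apply/mpolyP => m; rewrite mcoeffC.
have [->|m0] := eqVneq m 0%MM; first by rewrite mulr1.
rewrite mulr0; apply: memN_msupp_eq0; apply: contra m0 => /hom /= /eqP.
by rewrite mdeg_eq0.
Qed.

Lemma mpolyC_mulX (c : B) (m : 'X_{1..n}) :
  c *: 'X_[m] = 'X_[m] * c%:MP :> {mpoly B[n]}.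
Proof. by rewrite -mul_mpolyC commr_mpolyX. Qed.

Lemma euler_homog k v : v \is k.-homog -> \sum_i 'X_i * v^`M(i) = v *+ k.
Proof.
move=> /dhomogP hom.
have eulerX (m : 'X_{1..n}) :
    \sum_i 'X_i * ('X_[m] : {mpoly B[n]})^`M(i) = 'X_[m] *+ mdeg m.
  rewrite mdegE -sumrMnr; apply: eq_bigr => i _.
  rewrite mderivX; case: (posnP (m i)) => [->|mi].
    by rewrite mulr0n scale0r mulr0.
  rewrite scaler_nat mulrnAr -mpolyXD addmC submK //.
  by apply/mnm_lepP => j; rewrite mnm1E; case: eqP => // <-.
rewrite [in LHS](mpolyE v) [in RHS](mpolyE v) -sumrMnl.
(* With coefficients to the right of the monomials, the Euler operator acts on the monomials
   alone. *)
transitivity (\sum_i \sum_(m <- msupp v) 'X_i * ('X_[m])^`M(i) * (v@_m)%:MP).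
  apply: eq_bigr => i _; rewrite raddf_sum mulr_sumr /=; apply: eq_bigr => m _.
  by rewrite mpolyC_mulX mderivM mderivC mulr0 addr0 mulrA.
rewrite exchange_big /= !big_seq; apply: eq_bigr => m /hom /= <-.
by rewrite -mulr_suml eulerX mulrnAl -mpolyC_mulX.
Qed.

Lemma mcoeff0_pihomog0 v : (pihomog mdeg 0 v)@_0%MM = v@_0%MM.
Proof.
elim/mpolyind: v => [|c m p _ _ IH]; first by rewrite pihomog0.
rewrite pihomogD linearZ /= !mcoeffD !mcoeffZ IH pihomogX mdeg_eq0 mcoeffX.
by case: eqP => [->|_]; rewrite ?mcoeffX ?eqxx ?mcoeff0.
Qed.

Lemma mderiv_const_rmul i v (c : B) : (v * c%:MP)^`M(i) = v^`M(i) * c%:MP.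
Proof. by rewrite mderivM mderivC mulr0 addr0. Qed.

End HomogeneousPolynomials.

(** * The action on Clifford-valued polynomials and its subrepresentations *)

Section Representation.
Variables (R : realType) (n : nat).
Local Notation C := (R[i]).
Variable eta : 'M[C]_n.
Hypotheses (eta_sym : eta^T = eta) (eta_inv : eta \in unitmx).
Variables (Cl : algType C) (gam : 'I_n -> Cl).
Hypothesis hCl : is_clifford_algebra eta gam.
Variables (A : algType C) (x d g : 'I_n -> A).
Hypothesis hA : is_weyl_clifford eta x d g.
Local Notation V := {mpoly Cl[n]}.
Variable rho : A -> V -> V.
Hypothesis hrho : is_WCl_action gam x d g rho.

Let relA := hA.1.
Let rhoDl a b v : rho (a + b) v = rho a v + rho b v. Proof. exact: hrho.1. Qed.
Let rhoM a b v : rho (a * b) v = rho a (rho b v). Proof. exact: hrho.2.1. Qed.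
Let rho1 v : rho 1 v = v. Proof. exact: hrho.2.2.1. Qed.
Let rhoZ c a v : rho (c *: a) v = (c%:A : Cl)%:MP * rho a v.
Proof. exact: hrho.2.2.2.1. Qed.
Let rhoDr a v w : rho a (v + w) = rho a v + rho a w.
Proof. exact: hrho.2.2.2.2.1. Qed.
Let rhox i v : rho (x i) v = 'X_i * v. Proof. exact: hrho.2.2.2.2.2.1. Qed.
Let rhog i v : rho (g i) v = (gam i)%:MP * v.
Proof. exact: hrho.2.2.2.2.2.2.1. Qed.
Let rhod i v : rho (d i) v = v^`M(i). Proof. exact: hrho.2.2.2.2.2.2.2. Qed.

Let NormId i : NormI eta d g (d i).
Proof. exact: (NormI_d relA). Qed.
Let NormIEu : NormI eta d g (euler x d).
Proof. exact: (NormI_euler relA). Qed.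

Let rho0r a : rho a 0 = 0.
Proof. by apply: (addrI (rho a 0)); rewrite -rhoDr !addr0. Qed.
Let rho0l v : rho 0 v = 0.
Proof. by apply: (addrI (rho 0 v)); rewrite -rhoDl !addr0. Qed.
Let rhoBl a b v : rho (a - b) v = rho a v - rho b v.
Proof. by apply/eqP; rewrite eq_sym subr_eq -rhoDl subrK. Qed.
Let rhoMn k v : rho k%:R v = v *+ k.
Proof. by elim: k => [|k IH]; rewrite ?rho0l // !mulrS rhoDl rho1 IH. Qed.
Let rho_suml (F : 'I_n -> A) v : rho (\sum_i F i) v = \sum_i rho (F i) v.
Proof. exact: (big_morph (rho^~ v) (fun a b => rhoDl a b v) (rho0l v)). Qed.

(** It suffices to check generators, which act by left multiplications and derivatives. *)
Lemma rho_rmul a (c : Cl) v : rho a (v * c%:MP) = rho a v * c%:MP.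
Proof.
move: a v; apply: (weyl_clifford_ind hA).
  split=> [v|a b ha hb v|a b ha hb v|s a ha v].
  - by rewrite !rho1.
  - by rewrite !rhoDl ha hb mulrDl.
  - by rewrite !rhoM hb ha.
  - by rewrite !rhoZ ha mulrA.
- by move=> i v; rewrite !rhox mulrA.
- by move=> i v; rewrite !rhod mderiv_const_rmul.
- by move=> i v; rewrite !rhog mulrA.
Qed.

Let D := dirac d g.
Let Eu := euler x d.

Lemma VplusP v : Vplus d g rho v <-> rho D v = 0.
Proof.
rewrite /Vplus Xel_dirac rhoZ mul_mpolyC; split=> [h|->]; last by rewrite scaler0.
rewrite -[rho D v]scale1r -[1](_ : ((('i / sqrtC 2)^-1 * ('i / sqrtC 2)) *: 1) = 1 :> Cl).
  by rewrite -[_ * _ *: 1]scalerA -[_ *: (_ *: 1)]mul1r -scalerAr scalerAl -scalerA h scaler0.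
by rewrite mulVf ?scale1r // Xel_scalar_neq0.
Qed.

Lemma rho_euler_homog k v : v \is k.-homog -> rho Eu v = v *+ k.
Proof.
move=> /euler_homog <-; rewrite rho_suml; apply: eq_bigr => i _.
by rewrite rhoM rhod rhox.
Qed.

Lemma Vplus_const (c : Cl) : Vplus d g rho c%:MP.
Proof.
apply/VplusP; rewrite rho_suml big1 // => i _.
by rewrite rhoM rhod mderivC rho0r.
Qed.

Lemma Iideal_Vplus a v : Iideal eta d g a -> Vplus d g rho v -> rho a v = 0.
Proof.
move=> /(IidealP relA) [p ->] /VplusP h.
by rewrite rhoM h rho0r.
Qed.

Lemma Vplus_NormI a v :
  NormI eta d g a -> Vplus d g rho v -> Vplus d g rho (rho a v).
Proof.
move=> /(NormIP relA) [p h] /VplusP Dv; apply/VplusP.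
by rewrite -rhoM h rhoM Dv rho0r.
Qed.

Lemma Vplus_rmul c v : Vplus d g rho v -> Vplus d g rho (v * c%:MP).
Proof. by move=> /VplusP Dv; apply/VplusP; rewrite rho_rmul Dv mul0r. Qed.

Lemma subrep_Vplus : subrep eta d g rho (Vplus d g rho).
Proof.
split=> //; split; first by apply/VplusP.
split; last by split; [exact: Vplus_NormI | move=> c v; exact: Vplus_rmul].
by move=> v w /VplusP Dv /VplusP Dw; apply/VplusP; rewrite rhoDr Dv Dw addr0.
Qed.

Section Subrepresentation.
Variable W : V -> Prop.
Hypothesis subW : subrep eta d g rho W.

Let WV v : W v -> Vplus d g rho v. Proof. exact: subW.1. Qed.
Let W0 : W 0. Proof. exact: subW.2.1. Qed.
Let WD v w : W v -> W w -> W (v + w). Proof. exact: subW.2.2.1. Qed.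
Let WN a v : NormI eta d g a -> W v -> W (rho a v).
Proof. exact: subW.2.2.2.1. Qed.
Let Wr (c : Cl) v : W v -> W (v * c%:MP). Proof. exact: subW.2.2.2.2. Qed.

(** Negation, and division by integers below, come from right multiplication by scalars of [Cl]. *)
Lemma subrep_opp v : W v -> W (- v).
Proof. by move/(Wr (-1)); rewrite mpolyCN mulrN mulr1. Qed.

Lemma subrep_div v k : W (v *+ k.+1) -> W v.
Proof.
move/(Wr (k.+1%:R^-1%:A)); rewrite mulrnAl -mulrnAr -mpolyCMn.
by rewrite scalerMnl -[k.+1%:R^-1 *+ _]mulr_natr mulVf ?pnatr_eq0 // scale1r mulr1.
Qed.

Lemma subrep_homog v k : W v -> W (pihomog mdeg k v).
Proof.
move=> Wv; have [ltk|lek] := ltnP k (msize v); last first.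
  rewrite (_ : pihomog mdeg k v = 0) //; rewrite pihomogE big_seq_cond big1 // => m.
  by move=> /andP [/msize_mdeg_lt /leq_trans /(_ lek)]; rewrite ltn_neqAle => /andP [/negbTE ->].
have h := @pihomog_partitionE _ _ mdeg _ v (leqnn (msize v)).
apply: (eigen_component (T := rho Eu) (P := W) _ WD subrep_opp subrep_div _
  (u := fun k => pihomog mdeg k v)) ltk.
- exact: rhoDr.
- by move=> u; apply: WN.
- by move=> l; apply: rho_euler_homog; apply: pihomogP.
- by rewrite -h.
Qed.

Lemma subrep_mderivm v m : W v -> W v^`M[m].
Proof.
move=> Wv; rewrite /mderivm; elim: (enum _) => //= i s IH.
by elim: (m i) => //= k IHk; rewrite -rhod; apply: WN.
Qed.

(** The constant term of the derivative of [v] along [m] is [v@_m] times the product of the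
    factorials of the exponents; project to degree 0 and divide. *)
Lemma subrep_coeff v m : W v -> deg0 W v@_m.
Proof.
move=> Wv; have := subrep_homog 0 (subrep_mderivm m Wv).
rewrite [pihomog _ _ _]homog0_const ?pihomogP // mcoeff0_pihomog0.
rewrite mcoeff_mderivm addm0 mpolyCMn.
have : (0 < \prod_(i < n) (m i) ^_ (m i))%N.
  by apply: prodn_gt0 => i; rewrite ffact_gt0.
by case: (\prod_(i < n) _)%N => // k _; apply: subrep_div.
Qed.

Lemma rho_rotation_const i (c : Cl) :
  rho (rotation eta x d g i) c%:MP =
  (gam i * c)%:MP *+ n - (gam i * c)%:MP - (gam i * c)%:MP.
Proof.
have up0 : rho (d_up eta d i) c%:MP = 0.
  by rewrite rho_suml big1 // => j _; rewrite rhoZ rhod mderivC mulr0.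
have eu0 : rho (euler x d) c%:MP = 0.
  by rewrite rho_suml big1 // => j _; rewrite rhoM rhod mderivC rho0r.
rewrite !rhoBl !rhoM up0 rho0r !subr0 rhog !rhoBl rho1 !rhoDl eu0 !addr0 rhoMn.
by rewrite !mulrBr mulrnAr -mpolyCM.
Qed.

Lemma reg_subrep_deg0 : (0 < n)%N -> n != 2%N -> reg_subrep (deg0 W).
Proof.
move=> n_gt0 n2; split; first by rewrite /deg0 mpolyC0.
have JD a b : deg0 W a -> deg0 W b -> deg0 W (a + b).
  by rewrite /deg0 mpolyCD; apply: WD.
have Jr a c : deg0 W c -> deg0 W (c * a).
  by rewrite /deg0 mpolyCM; apply: Wr.
split=> //; split=> //.
apply: (clifford_ind hCl).
  split=> [c|a b ha hb c hc|a b ha hb c hc|s a ha c hc].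
  - by rewrite mul1r.
  - by rewrite mulrDl; apply: JD; [apply: ha | apply: hb].
  - by rewrite -mulrA; apply/ha/hb.
  - by rewrite -scalerAl -mulr_algr; apply/Jr/ha.
(* Division by [N - 2]: for [N = 1] this is a sign change, and for [N > 2] a positive integer. *)
have Wdiv (N : nat) u : (0 < N)%N -> N != 2%N -> W (u *+ N - u - u) -> W u.
  case: N => [|[|[|N]]] // _ _.
    by rewrite mulr1n subrr sub0r => /subrep_opp; rewrite opprK.
  by rewrite mulrSr addrK mulrSr addrK; apply: subrep_div.
move=> i c Wc; apply: Wdiv n_gt0 n2 _.
rewrite -rho_rotation_const; apply: WN => //.
exact: (NormI_rotation eta_sym eta_inv relA).
Qed.

End Subrepresentation.

(** The inverse of [deg0], sending a two-sided ideal to a subrepresentation. *)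
Definition coeff_sub (J : Cl -> Prop) (v : V) : Prop :=
  Vplus d g rho v /\ forall m, J v@_m.

Lemma rho_coeff (J : Cl -> Prop) a v :
  reg_subrep J -> (forall m, J v@_m) -> forall m, J (rho a v)@_m.
Proof.
move=> [J0 [JD [Jl Jr]]]; move: a v.
have JMn c k : J c -> J (c *+ k).
  by move=> Jc; elim: k => [|k IHk]; rewrite ?mulr0n // mulrS; apply: JD.
have Jmul (u v : V) : (forall m, J v@_m) -> forall m, J (u * v)@_m.
  by move=> Jv m; rewrite mcoeffM; apply: big_ind => // k _; apply: Jl.
apply: (weyl_clifford_ind hA).
  split=> [v Jv m|a b ha hb v Jv m|a b ha hb v Jv m|s a ha v Jv m].
  - by rewrite rho1.
  - by rewrite rhoDl mcoeffD; apply: JD; [apply: ha | apply: hb].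
  - by rewrite rhoM; apply/ha/hb.
  - by rewrite rhoZ; apply/Jmul/ha.
- by move=> i v Jv m; rewrite rhox; apply: Jmul.
- by move=> i v Jv m; rewrite rhod mcoeff_deriv; apply: JMn.
- by move=> i v Jv m; rewrite rhog; apply: Jmul.
Qed.

Lemma subrep_coeff_sub J : reg_subrep J -> subrep eta d g rho (coeff_sub J).
Proof.
move=> regJ; have [J0 [JD [Jl Jr]]] := regJ.
have [_ [V0 [VD [VN Vr]]]] := subrep_Vplus.
split; first by move=> v [].
split; first by split=> // m; rewrite mcoeff0.
split.
  move=> v w [Vv Jv] [Vw Jw]; split; first exact: VD.
  by move=> m; rewrite mcoeffD; apply: JD.
split=> [a v Na [Vv Jv]|c v [Vv Jv]]; split.
- exact: VN.
- exact: rho_coeff.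
- exact: Vr.
- by move=> m; rewrite mcoeffM; apply: big_ind => // k _; apply: Jr.
Qed.

Lemma deg0_coeff_sub J c : reg_subrep J -> deg0 (coeff_sub J) c <-> J c.
Proof.
move=> [J0 [_ [_ Jr]]]; split=> [[_ /(_ 0%MM)]|Jc].
  by rewrite mcoeffC eqxx mulr1.
split; first exact: Vplus_const.
by move=> m; rewrite mcoeffC; apply: Jr.
Qed.

(** * The correspondence between subrepresentations and two-sided ideals *)

Hypotheses (n_gt0 : (0 < n)%N) (n_neq2 : n != 2%N).

(** In degree [k + 1], [euler] acts by [k + 1] and [weight - 2] by [n + 2 (k + 1) - 2 = n + 2 k];
    the multiple of [dirac] kills solutions. *)
Lemma rho_sum_raising_d k v : v \is k.+1.-homog -> Vplus d g rho v ->
  \sum_i rho (raising eta x d g i) (rho (d i) v) = v *+ ((n + k + k) * k.+1).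
Proof.
move=> hv /VplusP Dv.
have [p sumE] := sum_raising_d relA.
under eq_bigr do rewrite -rhoM.
rewrite -rho_suml sumE rhoBl !rhoM Dv rho0r subr0 !rhoBl !rhoDl rhoMn rho1.
rewrite (rho_euler_homog hv) -!mulrnDr !(addnS, addSn) !mulrSr !addrK.
rewrite mulrnA -(rho_euler_homog (k := k.+1)) //; exact: rpredMn.
Qed.

Lemma subrep_homogE W k v : subrep eta d g rho W ->
  v \is k.-homog -> coeff_sub (deg0 W) v -> W v.
Proof.
move=> subW; have subJ := subrep_coeff_sub (reg_subrep_deg0 subW n_gt0 n_neq2).
have [_ [W0 [WD [WN Wr]]]] := subW.
have [_ [_ [_ [JN _]]]] := subJ.
elim: k v => [|k IH] v hv Jv.
  by rewrite (homog0_const hv); apply: (proj2 Jv).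
apply: (subrep_div subW (k := ((n + k + k) * k.+1).-1)).
rewrite prednK; last by rewrite muln_gt0 -addnA addn_gt0 n_gt0.
rewrite -rho_sum_raising_d //; last exact: (proj1 Jv).
apply: big_ind => // i _; apply: WN; first exact: (NormI_raising eta_sym eta_inv relA).
apply: IH; first by rewrite rhod mderiv_homog.
exact: JN.
Qed.

(** For the converse direction [v] is split by degree; [coeff_sub (deg0 W)] is itself a
    subrepresentation, so it contains the homogeneous components of [v]. *)
Lemma subrepE W v : subrep eta d g rho W -> W v <-> coeff_sub (deg0 W) v.
Proof.
move=> subW; have [WV [W0 [WD _]]] := subW.
split=> [Wv|Jv]; first by split=> [|m]; [apply: WV | apply: subrep_coeff].
have subJ := subrep_coeff_sub (reg_subrep_deg0 subW n_gt0 n_neq2).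
rewrite (@pihomog_partitionE _ _ mdeg _ v (leqnn (msize v))).
apply: big_ind => // k _.
by apply: subrep_homogE (pihomogP _ _ _) _ => //; apply: subrep_homog.
Qed.

(** Minimality transfers because [deg0] and [coeff_sub] are mutually inverse and preserve
    inclusions. *)
Lemma irred_subrepP W : subrep eta d g rho W ->
  irred_subrep eta d g rho W <-> reg_irred (deg0 W).
Proof.
move=> subW; have regW := reg_subrep_deg0 subW n_gt0 n_neq2.
split=> [[_ [[v [Wv v0]] minW]]|[_ [[c [Wc c0]] minJ]]].
  split=> //; split.
    have [[m vm]|h] := EM (exists m, v@_m <> 0).
      by exists v@_m; split=> //; apply: subrep_coeff.
    case: v0; apply/mpolyP => m; rewrite mcoeff0.
    by have [//|vm] := EM (v@_m = 0); case: h; exists m.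
  move=> J' regJ' leJ.
  case: (minW _ (subrep_coeff_sub regJ')).
  - by move=> w [Vw Jw]; apply/subrepE => //; split=> // m; apply: leJ.
  - move=> h; left=> c Jc; have /h : coeff_sub J' c%:MP by apply/deg0_coeff_sub.
    by move/eqP; rewrite mpolyC_eq0 => /eqP.
  - by move=> h; right=> c Wc; apply/deg0_coeff_sub => //; apply: h.
split=> //; split.
  by exists c%:MP; split=> // /eqP; rewrite mpolyC_eq0 => /eqP.
move=> W' subW' leW.
have regW' := reg_subrep_deg0 subW' n_gt0 n_neq2.
case: (minJ _ regW'); first by move=> b; apply: leW.
- move=> h; left=> v /subrepE-/(_ subW') [_ hv].
  by apply/mpolyP => m; rewrite mcoeff0; apply: h.
- move=> h; right=> v /subrepE-/(_ subW) [Vv hv].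
  by apply/subrepE => //; split=> // m; apply: h.
Qed.

End Representation.

Theorem theorem7p5 (R : realType) (n : nat) (eta : 'M[R[i]]_n)
  (hn : (0 < n)%N) (hn2 : n != 2%N)
  (eta_sym : eta^T = eta) (eta_inv : eta \in unitmx)
  (Cl : algType R[i]) (gam : 'I_n -> Cl) (hCl : is_clifford_algebra eta gam)
  (A : algType R[i]) (x d g : 'I_n -> A) (hA : is_weyl_clifford eta x d g)
  (rho : A -> {mpoly Cl[n]} -> {mpoly Cl[n]})
  (hrho : is_WCl_action gam x d g rho) :
  (* V^+ is a representation of Z_n (x) Cl(eta)^op *)
  (forall a v, NormI eta d g a -> Vplus d g rho v -> Vplus d g rho (rho a v)) /\
  (forall a v, Iideal eta d g a -> Vplus d g rho v -> rho a v = 0) /\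
  (forall (c : Cl) v, Vplus d g rho v -> Vplus d g rho (v * c%:MP)) /\
  (forall a (c : Cl) v, NormI eta d g a -> Vplus d g rho v ->
      rho a (v * c%:MP) = rho a v * c%:MP) /\
  (* its irreducible subrepresentations correspond (via W |-> W ∩ Cl(eta))
     to those of the regular representation of Cl(eta) *)
  (forall W, irred_subrep eta d g rho W -> reg_irred (deg0 W)) /\
  (forall W1 W2, irred_subrep eta d g rho W1 -> irred_subrep eta d g rho W2 ->
      (forall c, deg0 W1 c <-> deg0 W2 c) -> forall v, W1 v <-> W2 v) /\
  (forall J, reg_irred J ->
      exists W, irred_subrep eta d g rho W /\ forall c, J c <-> deg0 W c) /\
  (* in particular, for n even V^+ is irreducible *)
  (~~ odd n -> irred_subrep eta d g rho (Vplus d g rho)).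
Proof.
have subE W (subW : subrep eta d g rho W) v :=
  subrepE eta_sym eta_inv hCl hA hrho hn hn2 v subW.
have irrE W (subW : subrep eta d g rho W) :=
  irred_subrepP eta_sym eta_inv hCl hA hrho hn hn2 subW.
have subV := subrep_Vplus hA hrho.
split; first by move=> a v; apply: (Vplus_NormI hA hrho).
split; first by move=> a v; apply: (Iideal_Vplus hA hrho).
split; first by move=> c v; apply: (Vplus_rmul hA hrho).
split; first by move=> a c v _ _; apply: (rho_rmul hA hrho).
split; first by move=> W irrW; apply/irrE => //; apply: irrW.1.
split.
  move=> W1 W2 [sub1 _] [sub2 _] W12 v.
  rewrite (subE _ sub1) (subE _ sub2).
  by split=> [] [Vv Wv]; split=> // m; apply/W12.
split.
  move=> J irrJ; have regJ := irrJ.1.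
  have subJ := subrep_coeff_sub hA hrho regJ.
  have degE c := deg0_coeff_sub hrho c regJ.
  exists (coeff_sub d g rho J); split=> [|c]; last by rewrite degE.
  apply/irrE => //; rewrite (_ : deg0 _ = J) //.
  by apply/funext => c; apply/propext.
(* Every constant is a solution, so the ideal attached to the whole space is [Cl], and the claim
   becomes simplicity of [Cl]. *)
move=> even_n; apply/irrE => //.
have Vc (c : Cl) : deg0 (Vplus d g rho) c.
  exact: (Vplus_const hrho).
split; first by do !split.
split; first by exists 1; split=> //; apply/eqP; apply: oner_neq0.
move=> J regJ _; have [[c [Jc c0]]|J0] := EM (exists c, J c /\ c <> 0).
  right=> b _; rewrite -[b]mulr1; apply: (regJ.2.2.1).
  exact: (clifford_simple eta_sym eta_inv hCl even_n regJ Jc c0).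
by left=> c Jc; have [//|c0] := EM (c = 0); case: J0; exists c.
Qed.
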